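(* Let $n\ge k\ge 1$ and let $f\in\mathbb{F}_q[x]$ be monic of degree $d\le k$, with factorization $f=f_1^{e_1}\cdots f_t^{e_t}$ into distinct monic irreducibles $f_i$ of degree $d_i$. Then $$\left|\Phi_{n,k}^{-1}(f)\right|={k\brack d}_q\,\frac{q^{d^2-d}F(q,d)}{\prod_{i=1}^{t}F(q^{d_i},e_i)}\prod_{i=d+1}^{k}(q^n-q^i).$$
   Context: $\mathbb{F}_q$ is the finite field with $q$ elements. $I_{n,k}\in M_{n,k}(\mathbb{F}_q)$ has $(i,j)$ entry $1$ if $i=j$ and $0$ otherwise. For a polynomial matrix $M\in M_{n,k}(\mathbb{F}_q[x])$, $\delta_k(M)$ denotes its $k$-th determinantal divisor, the monic gcd of all its $k\times k$ minors. The map $\Phi_{n,k}:M_{n,k}(\mathbb{F}_q)\to\mathbb{F}_q[x]$ is $\Phi_{n,k}(A)=\delta_k(xI_{n,k}-A)$ (for $n=k$ this is the characteristic polynomial). For a nonnegative integer $r$, $F(q,r)=\prod_{i=1}^{r}(1-q^{-i})$ (so $F(q,0)=1$). ${k\brack d}_q=\prod_{i=0}^{d-1}\frac{q^{k-i}-1}{q^{i+1}-1}$ is the $q$-binomial coefficient. Empty products equal $1$. *)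

(* Defs.v *)
From HB Require Import structures.
From mathcomp Require Import all_boot all_order all_algebra all_field.
Set Implicit Arguments. Unset Strict Implicit. Unset Printing Implicit Defensive.
Import Order.TTheory GRing.Theory Num.Theory.
Local Open Scope ring_scope.

Definition xImA (F : fieldType) (n k : nat) (A : 'M[F]_(n, k)) : 'M[{poly F}]_(n, k) :=
  \matrix_(i < n, j < k) ((nat_of_ord i == nat_of_ord j)%:R *: 'X - (A i j)%:P).

Definition incr_rows (n k : nat) (r : 'I_k -> 'I_n) : bool :=
  [forall i : 'I_k, forall j : 'I_k, (i < j)%N ==> (r i < r j)%N].

(* monic normalization of a polynomial (0 stays 0) *)
Definition monic_part (F : fieldType) (p : {poly F}) : {poly F} :=
  (lead_coef p)^-1 *: p.

Definition delta (F : fieldType) (n k : nat) (M : 'M[{poly F}]_(n, k)) : {poly F} :=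
  monic_part (\big[@gcdp F/0]_(r : {ffun 'I_k -> 'I_n} | incr_rows r)
                 \det (rowsub r M)).

Definition Phi (F : fieldType) (n k : nat) (A : 'M[F]_(n, k)) : {poly F} :=
  delta (xImA A).

Definition Fq (q : rat) (r : nat) : rat := \prod_(i < r) (1 - q ^- i.+1).

Definition qbinom (q : rat) (k d : nat) : rat :=
  \prod_(i < d) ((q ^+ (k - i) - 1) / (q ^+ i.+1 - 1)).

(* Main.v *)
(* Write [A = col_mx T C] and view [(T, C)] as a linear system [x' = T x],
   [y = C x]. In Kalman form the unobservable part of the system is a block [T'],
   and [Phi A = char_poly T'], since an observable pair has a polynomial left
   inverse (Bezout). Double counting the changes of basis that lead to Kalman form gives,
   with [g_j = |GL_j|], [d = deg f] and [r = k - d],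
     |Phi^-1(f)| / g_k = (c(f) / g_d) (o_r / g_r),
   where [c(f)] counts the matrices with characteristic polynomial [f] and [o_r]
   the observable pairs. Two specializations determine these numbers:
   - for a single output row ([m = 1]) and [char_poly T = f] fixed, the observable
     pairs with given characteristic polynomial are a torsor under [GL], so that
     [w(f) = c(f) / g_d] satisfies [q ^ d w(f) = sum_(h | f) w(h)];
   - summing over all [f] determines [o_r] by a q-binomial identity. *)

Require Import Defs.
From HB Require Import structures.
From mathcomp Require Import all_boot all_order all_algebra all_field.
From mathcomp Require Import perm ring.
Import Order.TTheory GRing.Theory Num.Theory.
Local Open Scope ring_scope.
Set Implicit Arguments.
Unset Strict Implicit.
Unset Printing Implicit Defensive.

(** * Determinantal divisors *)

(** Cauchy-Binet before regrouping: distribute the product over all maps [r], then collect the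
    signed sum over [s] into a minor. *)
Lemma det_mul_rowsub (R : comNzRingType) (k n : nat)
    (Q : 'M[R]_(k, n)) (M : 'M[R]_(n, k)) :
  \det (Q *m M) =
    \sum_(r : {ffun 'I_k -> 'I_n}) (\prod_i Q i (r i)) * \det (rowsub r M).
Proof.
transitivity (\sum_(s : 'S_k) (-1) ^+ s *
    \sum_(r : {ffun 'I_k -> 'I_n}) \prod_i (Q i (r i) * M (r i) (s i))).
  apply: eq_bigr => s _; congr (_ * _).
  rewrite -(bigA_distr_bigA (fun i l => Q i l * M l (s i))).
  by apply: eq_bigr => i _; rewrite mxE.
under eq_bigr do rewrite mulr_sumr.
rewrite exchange_big; apply: eq_bigr => r _; rewrite mulr_sumr.
apply: eq_bigr => s _; rewrite big_split mulrCA; congr (_ * (_ * _)).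
by apply: eq_bigr => i _; rewrite mxE.
Qed.

Lemma injective_incr_rows (k n : nat) (r : {ffun 'I_k -> 'I_n}) :
  injective r ->
  exists s : 'S_k, incr_rows [ffun i => r (s i)].
Proof.
move=> r_inj; pose t := [tuple r i | i < k].
have /perm.tuple_permP[s Es] : perm_eq (sort_tuple <=%O t) t by rewrite perm_sort.
exists s.
have Et i : [ffun i => r (s i)] i = tnth (sort_tuple <=%O t) i.
  by rewrite ffunE; move/val_inj: Es => ->; rewrite !tnth_mktuple.
apply/forallP => i; apply/forallP => j; apply/implyP => lt_ij.
rewrite !Et.
have st : sorted <%O (sort <=%O t).
  rewrite sort_lt_sorted map_inj_uniq ?enum_uniq //.
have x0 : 'I_n := r i.
rewrite !(tnth_nth x0) /=.
have := sorted_ltn_nth lt_trans x0 st => /(_ i j).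
rewrite !inE size_sort size_tuple => /(_ (ltn_ord i) (ltn_ord j) lt_ij).
by [].
Qed.

(** In the expansion, a map [r] with a repeated value gives two equal rows; an injective one is
    sorted by a permutation, which changes the minor by a sign only. *)
Lemma dvdp_minors (F : fieldType) (n k : nat) (M : 'M[{poly F}]_(n, k)) (g : {poly F}) :
  (forall r : {ffun 'I_k -> 'I_n}, incr_rows r -> g %| \det (rowsub r M)) ->
  forall Q : 'M_(k, n), g %| \det (Q *m M).
Proof.
move=> dvd_g Q; rewrite det_mul_rowsub.
apply: (big_ind (fun p => g %| p)) => [|p1 p2|r _]; [exact: dvdp0|exact: dvdp_add|].
apply: dvdp_mull.
have [/injectiveP r_inj|/injectivePn[i [j ne_ij eq_r]]] := boolP (injectiveb r); last first.
  rewrite (@determinant_alternate _ _ _ i j) ?dvdp0 // => l.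
  by rewrite !mxE eq_r.
have [s /dvd_g] := injective_incr_rows r_inj.
suff -> : rowsub [ffun i => r (s i)] M = row_perm s (rowsub r M).
  rewrite row_permE det_mulmx det_perm => /dvdp_trans-> //.
  rewrite -signr_odd; case: (odd _).
    by rewrite expr1 mulN1r dvdpNl.
  by rewrite expr0 mul1r.
by apply/matrixP => i j; rewrite !mxE ffunE.
Qed.

Lemma dvdp_big_gcd (F : fieldType) (I : finType) (P : pred I) (f : I -> {poly F}) g :
  (g %| \big[@gcdp F/0]_(i | P i) f i) = [forall (i | P i), g %| f i].
Proof.
apply/idP/forall_inP => [dvd_g i Pi|dvd_g].
  have: i \in index_enum I by rewrite mem_index_enum.
  elim: (index_enum I) dvd_g => // j e IHe; rewrite big_cons inE.
  case: ifPn => [Pj|nPj].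
    rewrite dvdp_gcd => /andP[gj ge] /predU1P[-> //|]; exact: IHe.
  by move=> ge /predU1P[E|]; [rewrite -E Pi in nPj|exact: IHe].
elim/big_rec: _ => [|i p Pi gp]; first exact: dvdp0.
by rewrite dvdp_gcd dvd_g.
Qed.

(* A k-minor is [\det (Q *m M)] for a selection matrix [Q], and by Cauchy-Binet
   every [\det (Q *m M)] is a combination of the k-minors. *)
Lemma dvdp_delta (F : fieldType) (n k : nat) (M : 'M[{poly F}]_(n, k)) (g : {poly F}) :
  g %| delta M <-> forall Q : 'M_(k, n), g %| \det (Q *m M).
Proof.
rewrite /delta /monic_part; set D := bigop _ _ _.
have -> : (g %| (lead_coef D)^-1 *: D) = (g %| D).
  have [->|D0] := eqVneq D 0; first by rewrite scaler0.
  by rewrite dvdpZr // invr_eq0 lead_coef_eq0.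
rewrite dvdp_big_gcd; split => [/forall_inP/dvdp_minors //|dvd_g].
apply/forall_inP => r _; have := dvd_g (rowsub r 1%:M).
by rewrite mul_rowsub_mx mul1mx.
Qed.

(** Computes [delta] without enumerating minors: a single well-chosen [Q] bounds the gcd, and monic
    associates are equal. *)
Lemma delta_eq (F : fieldType) (n k : nat) (M : 'M[{poly F}]_(n, k)) (h : {poly F}) :
  h \is monic -> (forall Q : 'M_(k, n), h %| \det (Q *m M)) ->
  (exists Q : 'M_(k, n), \det (Q *m M) %| h) -> delta M = h.
Proof.
move=> h_mon /dvdp_delta h_dvd [Q Qh].
have dvd_h : delta M %| h.
  by apply: dvdp_trans Qh; move: Q; apply/dvdp_delta.
have d_mon : delta M \is monic.
  (* A zero gcd would make [delta M] zero, which cannot divide the monic [h]. *)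
  move: dvd_h; rewrite /delta /monic_part; set D := bigop _ _ _.
  have [->|D0 _] := eqVneq D 0.
    by rewrite scaler0 dvd0p (negPf (monic_neq0 h_mon)).
  by rewrite monicE lead_coefZ mulVf ?lead_coef_eq0.
by apply/eqP; rewrite -eqp_monic // /eqp dvd_h h_dvd.
Qed.

(** * Observable pairs and the Kalman decomposition *)

Lemma horner_mx_sum (F : fieldType) (k : nat) (T : 'M[F]_k.+1) (p : {poly F}) :
  horner_mx T p = \sum_(j < size p) p`_j *: T ^+ j.
Proof.
rewrite -{1}[p]coefK poly_def rmorph_sum; apply: eq_bigr => j _ /=.
by rewrite linearZ rmorphXn /= horner_mx_X.
Qed.

(** By Cayley-Hamilton every power of [T] is a combination of the first [k] powers. *)
Lemma mul_expmx_eq0 (F : fieldType) (k m p : nat)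
    (T : 'M[F]_k) (C : 'M_(m, k)) (V : 'M_(k, p)) :
  (forall i : 'I_k, C *m T ^+ i *m V = 0) -> forall i, C *m T ^+ i *m V = 0.
Proof.
case: k T C V => [|k] T C V CTV0 i; first by rewrite [V]flatmx0 mulmx0.
have -> : T ^+ i = horner_mx T ('X^i %% char_poly T).
  rewrite -{1}[T]horner_mx_X -rmorphXn {1}(divp_eq 'X^i (char_poly T)).
  by rewrite rmorphD rmorphM /= Cayley_Hamilton mulr0 add0r.
rewrite horner_mx_sum mulmx_sumr mulmx_suml big1 // => j _.
have lt_jk : (j < k.+1)%N.
  apply: leq_trans (ltn_ord j) _; rewrite -ltnS -(size_char_poly T).
  by rewrite ltn_modp monic_neq0 ?char_poly_monic.
by rewrite -scalemxAr -scalemxAl (CTV0 (Ordinal lt_jk)) scaler0.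
Qed.

(** Restricting to exponents below [k] keeps the predicate boolean; [observableP] removes the
    bound. *)
Definition observable (F : finFieldType) (k m : nat) (T : 'M[F]_k) (C : 'M_(m, k)) :=
  [forall v : 'cV_k, [forall i : 'I_k, C *m T ^+ i *m v == 0] ==> (v == 0)].

Lemma observableP (F : finFieldType) (k m : nat) (T : 'M[F]_k) (C : 'M_(m, k)) :
  reflect (forall p (V : 'M_(k, p)), (forall i, C *m T ^+ i *m V = 0) -> V = 0)
          (observable T C).
Proof.
apply: (iffP forallP) => [obs p V CTV0 | obs v].
  apply/matrixP => i j; rewrite mxE.
  have /implyP/(_ _)/eqP := obs (col j V).
  move=> /(_ _)/matrixP/(_ i ord0); rewrite !mxE; apply.
  by apply/forallP => l; rewrite colE mulmxA CTV0 mul0mx.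
apply/implyP => /'forall_eqP CTv0; apply/eqP/obs; exact: mul_expmx_eq0.
Qed.

(** Modulo left multiples of [x I - T], multiplying by [T] is multiplying by [x], so each [C T^i]
    lies in the left module spanned by [x I - T] and [C]. By observability the rows of the [C T^i]
    span the whole space, so the identity lies there too. *)
Lemma observable_bezout (F : finFieldType) (k m : nat) (T : 'M[F]_k) (C : 'M_(m, k)) :
  observable T C ->
  exists (X : 'M_k) (Y : 'M_(k, m)),
    X *m char_poly_mx T + Y *m map_mx polyC C = 1%:M.
Proof.
move=> /observableP obs.
have CTi i : exists X Y, X *m char_poly_mx T + Y *m map_mx polyC C
                         = map_mx polyC (C *m T ^+ i).
  elim: i => [|i [X [Y IHi]]].
    by exists 0, 1%:M; rewrite mul0mx add0r mul1mx expr0 mulmx1.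
  (* Uses [C T = x C - C (x I - T)] and the commutation of [T] with [x I - T]. *)
  exists (X *m map_mx polyC T - Y *m map_mx polyC C), ('X *: Y).
  rewrite exprSr -[_ ^+ i * T]/(_ *m _) mulmxA [RHS]map_mxM -IHi /char_poly_mx.
  move: (map_mx polyC T) (map_mx polyC C) => T' C'.
  rewrite !mulmxDl !mulmxDr !mulmxDl !mulNmx !mulmxN !mul_mx_scalar -!scalemxAl.
  by rewrite opprK mulNmx -!addrA; do 2 congr (_ + _); rewrite addrC addrK.
have /sub_sumsmxP[u Eu] : (1%:M <= \sum_(i < k) <<C *m T ^+ i>>)%MS.
  (* The cokernel of [S] is killed by every [C T^i], hence vanishes. *)
  set S := (\sum_i _)%MS; rewrite submxE mul1mx; apply/eqP/obs.
  move=> i; move: i; apply: mul_expmx_eq0 => i.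
  apply/eqP; rewrite -submxE (sumsmx_sup i) // genmxE submx_refl //.
have Eu' : forall i : 'I_k, exists w, u i *m <<C *m T ^+ i>>%MS = w *m (C *m T ^+ i).
  by move=> i; apply/submxP; rewrite (submx_trans (submxMl _ _)) ?genmxE.
have {Eu Eu'} : exists w : 'I_k -> 'M_(k, m), 1%:M = \sum_i w i *m (C *m T ^+ i).
  have [w Ew] := fin_all_exists Eu'.
  by exists w; rewrite Eu; apply: eq_bigr => i _.
move=> [w Ew].
have [X EX] := fin_all_exists (fun i : 'I_k => CTi i).
have [Y EY] := fin_all_exists EX.
exists (\sum_i map_mx polyC (w i) *m X i), (\sum_i map_mx polyC (w i) *m Y i).
rewrite !mulmx_suml -big_split -[RHS](map_mx1 polyC) Ew raddf_sum.
by apply: eq_bigr => i _; rewrite /= -!mulmxA -mulmxDr EY -map_mxM !mulmxA.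
Qed.

Lemma char_poly_conj (R : fieldType) (k : nat) (P T1 T2 : 'M[R]_k) :
  P \in unitmx -> P *m T1 = T2 *m P -> char_poly T1 = char_poly T2.
Proof.
move=> P_unit PT; pose Pp := map_mx polyC P.
have detP0 : \det Pp != 0 by rewrite det_map_mx polyC_eq0 -unitfE -unitmxE.
apply: (mulfI detP0); rewrite -det_mulmx mulrC -det_mulmx; congr (\det _).
rewrite /char_poly_mx mulmxBl mulmxBr -!map_mxM PT.
by rewrite mul_scalar_mx mul_mx_scalar.
Qed.

(** The matrix factors as a left-invertible one (by Bezout) times [K] times the invertible [Pp]. So
    each [\det (Q *m M)] is a multiple of [\det K], and the left inverse attains it up to a nonzero
    constant. *)
Lemma delta_kalman (F : finFieldType) (r d m : nat) (T P : 'M[F]_(r + d)) (C : 'M_(m, r + d))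
    (B : 'M_r) (E : 'M_(d, r)) (T' : 'M_d) (C' : 'M_(m, r)) :
  P \in unitmx -> observable B C' ->
  P *m T = block_mx B 0 E T' *m P -> C = row_mx C' 0 *m P ->
  delta (col_mx (char_poly_mx T) (- map_mx polyC C)) = char_poly T'.
Proof.
move=> P_unit /observable_bezout[X [Y XY]] PT defC.
pose Pp := map_mx polyC P; pose Pi := map_mx polyC (invmx P).
have PiP : Pi *m Pp = 1%:M by rewrite -map_mxM mulVmx ?map_mx1.
have PPi : Pp *m Pi = 1%:M by rewrite -map_mxM mulmxV ?map_mx1.
pose K : 'M_(r + d) := block_mx 1%:M 0 (- map_mx polyC E) (char_poly_mx T').
pose N1 : 'M_(r + d) := block_mx (char_poly_mx B) 0 0 1%:M.
pose N2 : 'M_(m, r + d) := row_mx (map_mx polyC C') 0.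
have detK : \det K = char_poly T' by rewrite det_lblock det1 mul1r.
have PxT : Pp *m char_poly_mx T = N1 *m K *m Pp.
  rewrite mulmxBr mul_mx_scalar -map_mxM PT map_mxM -mul_scalar_mx -mulmxBl.
  congr (_ *m _); rewrite mulmx_block map_block_mx !mulmx0 !mul0mx !mulmx1 !mul1mx.
  rewrite !addr0 !add0r scalar_mx_block opp_block_mx add_block_mx.
  by rewrite raddf0 subr0 !add0r.
have defC' : map_mx polyC C = N2 *m K *m Pp.
  rewrite defC map_mxM; congr (_ *m _); rewrite map_row_mx raddf0.
  by rewrite mul_row_block !mulmx0 !mul0mx !addr0 mulmx1.
apply: delta_eq; first exact: char_poly_monic.
  move=> Q; rewrite -[Q]hsubmxK mul_row_col.
  have -> : char_poly_mx T = Pi *m N1 *m K *m Pp.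
    by rewrite -!mulmxA [N1 *m _]mulmxA -PxT mulmxA PiP mul1mx.
  rewrite defC' mulmxN -mulNmx !mulmxA -!mulmxDl !det_mulmx detK.
  by rewrite dvdp_mulr // dvdp_mull.
(* The Bezout pair inverts the observable corner, the sign of [Y] matching the block [- C]; the
   product is [K *m Pp]. *)
exists (row_mx (block_mx X 0 0 1%:M *m Pp) (- col_mx Y 0)).
rewrite mul_row_col mulNmx mulmxN opprK -mulmxA PxT defC' !mulmxA -!mulmxDl.
rewrite mulmx_block mul_col_row !mulmx0 !mul0mx !addr0 !add0r add_block_mx XY.
rewrite !addr0 mulmx1 -scalar_mx_block mul1mx det_mulmx detK.
rewrite det_map_mx mulrC mul_polyC dvdpZl //.
by rewrite -unitfE -unitmxE.
Qed.

(** The row space [S] of all [C T^i] is stable under [T] and contains the rows of [C]; a basis whose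
    first [r] rows span [S] produces the zero blocks. *)
Lemma kalman_decomposition (F : finFieldType) (r d m : nat)
    (T : 'M[F]_(r + d)) (C : 'M_(m, r + d)) :
  \rank (\sum_(i < r + d) <<C *m T ^+ i>>)%MS = r ->
  exists (P : 'M_(r + d)) (B : 'M_r) (E : 'M_(d, r)) (T' : 'M_d) (C' : 'M_(m, r)),
    [/\ P \in unitmx, observable B C', P *m T = block_mx B 0 E T' *m P
      & C = row_mx C' 0 *m P].
Proof.
set S := (\sum_i _)%MS => rankS.
pose P := row_ebase S; pose L := col_ebase S.
have P_unit : P \in unitmx by exact: row_ebase_unit.
have defS : S = lsubmx L *m usubmx P.
  rewrite -[LHS]mulmx_ebase rankS -/L -/P -[in LHS](hsubmxK L) -[in LHS](vsubmxK P).
  by rewrite pid_mx_block mul_row_block mul_row_col !mulmx0 !mulmx1 !addr0 mul0mx addr0.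
have P1S : (usubmx P <= S)%MS.
  have: (S <= usubmx P)%MS by rewrite defS submxMl.
  move/mxrank_leqif_eq => [_]; rewrite rankS.
  suff -> : \rank (usubmx P) = r by rewrite eqxx => /esym /andP[].
  by apply/eqP; rewrite eqn_leq rank_leq_row -{1}rankS mxrankS // {1}defS submxMl.
have CTiS i : (C *m T ^+ i <= S)%MS.
  rewrite submxE; apply/eqP; move: i; apply: mul_expmx_eq0 => i.
  by apply/eqP; rewrite -submxE (sumsmx_sup i) // genmxE submx_refl.
have ST : (S *m T <= S)%MS.
  rewrite sumsmxMr; apply/sumsmx_subP => i _.
  by rewrite (eqmxMr _ (genmxE _)) -mulmxA -[T ^+ i *m T]exprSr.
have SP1 : (S <= usubmx P)%MS by rewrite defS submxMl.
have /submxP[B PB] : (usubmx P *m T <= usubmx P)%MS.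
  exact: submx_trans (submxMr _ P1S) (submx_trans ST SP1).
have /submxP[C' defC] : (C <= usubmx P)%MS.
  by apply: submx_trans SP1; have := CTiS 0; rewrite expr0 mulmx1.
pose Z := P *m T *m invmx P.
exists P, B, (dlsubmx Z), (drsubmx Z), C'; split=> //.
(* The upper rows of [P] send [v] to [y] and turn [C' B^i] into [C T^i]. Hence [S] kills [v], and so
   do those rows, which lie in [S]. *)
- apply/observableP => p y CBy0; pose v := invmx P *m col_mx y 0.
  have P1v : usubmx P *m v = y.
    by rewrite mul_usub_mx mulmxA mulmxV // mul1mx col_mxKu.
  have CBP i : C' *m B ^+ i *m usubmx P = C *m T ^+ i.
    elim: i => [|i IHi]; first by rewrite !expr0 !mulmx1.
    by rewrite !exprSr !mulmxA -IHi -!mulmxA PB.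
  have Sv : S *m v = 0.
    have: (S <= kermx v)%MS.
      by apply/sumsmx_subP => i _; rewrite genmxE; apply/sub_kermxP;
         rewrite mulmxA -CBP -!mulmxA P1v mulmxA CBy0.
    by move/sub_kermxP.
  by rewrite -P1v; apply/sub_kermxP/(submx_trans P1S)/sub_kermxP.
- rewrite -[LHS](mulmxKV P_unit) -/Z; congr (_ *m _).
  rewrite -[LHS]submxK.
  have: usubmx Z = row_mx B 0.
    rewrite /Z -!mul_usub_mx PB -mulmxA mul_usub_mx mulmxV //.
    by rewrite scalar_mx_block block_mxEv col_mxKu mul_mx_row mulmx1 mulmx0.
  by rewrite /ulsubmx /ursubmx => ->; rewrite row_mxKl row_mxKr.
- by rewrite defC -[in RHS](vsubmxK P) mul_row_col mul0mx addr0.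
Qed.

(** * Counting pairs by their Kalman form *)

Lemma xImA_col_mx (F : fieldType) (k m : nat) (T : 'M[F]_k) (C : 'M_(m, k)) :
  xImA (col_mx T C) = col_mx (char_poly_mx T) (- map_mx polyC C).
Proof.
apply/matrixP => i j; rewrite !mxE; case: split_ordP => l ->; rewrite !mxE /=.
  by rewrite scaler_nat.
by rewrite gtn_eqF ?scale0r ?add0r // (leq_trans (ltn_ord j)) // leq_addr.
Qed.

Lemma Phi_kalman (F : finFieldType) (r d m : nat) (T P : 'M[F]_(r + d)) (C : 'M_(m, r + d))
    (B : 'M_r) (E : 'M_(d, r)) (T' : 'M_d) (C' : 'M_(m, r)) :
  P \in unitmx -> observable B C' ->
  P *m T = block_mx B 0 E T' *m P -> C = row_mx C' 0 *m P ->
  Phi (col_mx T C) = char_poly T'.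
Proof. by rewrite /Phi xImA_col_mx; apply: delta_kalman. Qed.

Lemma char_poly_lblock (R : comNzRingType) (r d : nat)
    (B : 'M[R]_r) (E : 'M_(d, r)) (T' : 'M_d) :
  char_poly (block_mx B 0 E T') = char_poly B * char_poly T'.
Proof.
rewrite -(det_lblock _ (- map_mx polyC E)); congr (\det _).
rewrite /char_poly_mx map_block_mx scalar_mx_block opp_block_mx add_block_mx.
by rewrite raddf0 subr0 !add0r.
Qed.

(** Read off from the Kalman form: the size of the unobservable block is the codimension of the row
    space of the [C T^i]. *)
Lemma Phi_spec (F : finFieldType) (k m : nat) (T : 'M[F]_k) (C : 'M_(m, k)) :
  [/\ Phi (col_mx T C) \is monic, Phi (col_mx T C) %| char_poly T
    & size (Phi (col_mx T C)) = (k - \rank (\sum_(i < k) <<C *m T ^+ i>>)%MS).+1].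
Proof.
have [r rankS /subnKC/esym] :
    exists2 r, \rank (\sum_(i < k) <<C *m T ^+ i>>)%MS = r & (r <= k)%N.
  by exists (\rank (\sum_(i < k) <<C *m T ^+ i>>)%MS); rewrite ?rank_leq_row.
move: (k - r)%N => d Ek; subst k; rewrite rankS addKn.
have [P [B [E [T' [C' [P_unit obs PT defC]]]]]] := kalman_decomposition rankS.
rewrite (Phi_kalman P_unit obs PT defC) char_poly_monic size_char_poly.
by rewrite (char_poly_conj P_unit PT) char_poly_lblock dvdp_mull.
Qed.

Definition kalman_form (F : finFieldType) (r d m : nat)
    (z : 'M[F]_(r + d) * 'M[F]_(m, r + d)) :=
  [&& ursubmx z.1 == 0, rsubmx z.2 == 0 & observable (ulsubmx z.1) (lsubmx z.2)].

Definition conj_pair (F : fieldType) (k m : nat) (P : 'M[F]_k) (z : 'M[F]_k * 'M[F]_(m, k)) :=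
  (P *m z.1 *m invmx P, z.2 *m invmx P).

Lemma kalman_formE (F : finFieldType) (r d m : nat) (z : 'M[F]_(r + d) * 'M[F]_(m, r + d)) :
  kalman_form z ->
  z.1 = block_mx (ulsubmx z.1) 0 (dlsubmx z.1) (drsubmx z.1) /\ z.2 = row_mx (lsubmx z.2) 0.
Proof.
by case/and3P => /eqP z1 /eqP z2 _; rewrite -z1 -z2 submxK hsubmxK.
Qed.

(** The unobservable subspace is intrinsic: the right block of [z.2 *m z.1 ^+ i] vanishes, so every
    output of [w] kills [ursubmx P], and observability applies. *)
Lemma kalman_form_parabolic (F : finFieldType) (r d m : nat) (P : 'M[F]_(r + d))
    (z w : 'M[F]_(r + d) * 'M[F]_(m, r + d)) :
  kalman_form z -> kalman_form w ->
  P *m z.1 = w.1 *m P -> z.2 = w.2 *m P -> ursubmx P = 0.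
Proof.
move=> Kz Kw Pz1 z2; have [z1E z2E] := kalman_formE Kz; have [w1E w2E] := kalman_formE Kw.
case/and3P: (Kw) => _ _ /observableP; apply=> i.
have zwi : w.2 *m w.1 ^+ i *m P = z.2 *m z.1 ^+ i.
  elim: i => [|i IHi]; first by rewrite !expr0 !mulmx1.
  by rewrite !exprSr !mulmxA -IHi -!mulmxA Pz1.
have pow_form (y : 'M[F]_(r + d) * 'M[F]_(m, r + d)) j : kalman_form y ->
    y.2 *m y.1 ^+ j = row_mx (lsubmx y.2 *m ulsubmx y.1 ^+ j) 0.
  move=> Ky; have [y1E y2E] := kalman_formE Ky.
  elim: j => [|j IHj]; first by rewrite !expr0 !mulmx1.
  rewrite !exprSr mulmxA IHj [X in row_mx _ _ *m X = _]y1E mul_row_block !mulmx0 !mul0mx !addr0.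
  by rewrite mulmxA.
move/(congr1 rsubmx): zwi; rewrite !pow_form // row_mxKr.
by rewrite -{1}[P]submxK mul_row_block !mul0mx !addr0 row_mxKr.
Qed.

Lemma observable_conj (F : finFieldType) (r m : nat) (P T1 T2 : 'M[F]_r) (C1 C2 : 'M_(m, r)) :
  P \in unitmx -> P *m T1 = T2 *m P -> C1 = C2 *m P ->
  observable T1 C1 -> observable T2 C2.
Proof.
move=> P_unit PT defC /observableP obs; apply/observableP => p V C2V.
suff: invmx P *m V = 0.
  by move/(congr1 (mulmx P)); rewrite mulmxA mulmxV // mul1mx mulmx0.
apply: obs => i; suff -> : C1 *m T1 ^+ i = C2 *m T2 ^+ i *m P.
  by rewrite mulmxA mulmxK.
elim: i => [|i IHi]; first by rewrite !expr0 !mulmx1.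
by rewrite !exprSr !mulmxA IHi -!mulmxA PT.
Qed.

(** Converse of [kalman_form_parabolic]: the diagonal blocks of [P] are invertible, and the
    intertwining relations are compared block by block. *)
Lemma kalman_form_conj (F : finFieldType) (r d m : nat) (P : 'M[F]_(r + d))
    (z w : 'M[F]_(r + d) * 'M[F]_(m, r + d)) :
  P \in unitmx -> ursubmx P = 0 -> kalman_form z ->
  P *m z.1 = w.1 *m P -> z.2 = w.2 *m P ->
  kalman_form w /\ char_poly (drsubmx w.1) = char_poly (drsubmx z.1).
Proof.
move=> P_unit P0 Kz Pz1 z2; have [z1E z2E] := kalman_formE Kz.
have defP : P = block_mx (ulsubmx P) 0 (dlsubmx P) (drsubmx P) by rewrite -P0 submxK.
have [ul_unit dr_unit] : ulsubmx P \in unitmx /\ drsubmx P \in unitmx.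
  by apply/andP; rewrite !unitmxE -unitrM -(det_lblock _ (dlsubmx P)) -defP.
move: Pz1; rewrite z1E defP -{1}[w.1]submxK !mulmx_block !mulmx0 !mul0mx !addr0 !add0r.
case/eq_block_mx => Eul Eur _ Edr.
have ur0 : ursubmx w.1 = 0.
  by apply: (can_inj (mulmxK dr_unit)); rewrite mul0mx -Eur.
move: z2; rewrite z2E defP -{1}[w.2]hsubmxK mul_row_block !mulmx0 !add0r.
case/eq_row_mx => El Er.
have r0 : rsubmx w.2 = 0.
  by apply: (can_inj (mulmxK dr_unit)); rewrite mul0mx -Er.
move: Eul Edr El; rewrite ur0 r0 !mul0mx !addr0 => Eul Edr El.
split; last by rewrite block_mxKdr (char_poly_conj dr_unit Edr).
rewrite /kalman_form ur0 r0 !eqxx /=.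
by apply: observable_conj ul_unit Eul El _; case/and3P: Kz.
Qed.

Lemma conj_pairE (F : fieldType) (k m : nat) (P : 'M[F]_k) (z : 'M[F]_k * 'M[F]_(m, k)) :
  P \in unitmx ->
  P *m z.1 = (conj_pair P z).1 *m P /\ z.2 = (conj_pair P z).2 *m P.
Proof. by move=> P_unit; rewrite /= !mulmxKV. Qed.

Lemma conj_pair_inj (F : fieldType) (k m : nat) (P : 'M[F]_k) :
  P \in unitmx -> injective (@conj_pair F k m P).
Proof.
move=> P_unit [T1 C1] [T2 C2] [].
move/(can_inj (mulmxKV P_unit))/(can_inj (mulKmx P_unit)) => ->.
by move/(can_inj (mulmxKV P_unit)) => ->.
Qed.

Lemma conj_pairM (F : fieldType) (k m : nat) (P Q : 'M[F]_k) (z : 'M[F]_k * 'M[F]_(m, k)) :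
  P \in unitmx -> Q \in unitmx ->
  conj_pair (P *m Q) z = conj_pair P (conj_pair Q z).
Proof.
move=> P_unit Q_unit; have invM : invmx (P *m Q) = invmx Q *m invmx P.
  have PQ_unit : P *m Q \in unitmx by rewrite unitmx_mul P_unit.
  by apply: (can_inj (mulmxK PQ_unit)); rewrite mulVmx // -mulmxA mulKmx // mulVmx.
by rewrite /conj_pair invM !mulmxA.
Qed.

Definition card_unitmx (F : finFieldType) (n : nat) := #|[set P : 'M[F]_n | P \in unitmx]|.

Lemma card_parabolic (F : finFieldType) (r d : nat) :
  #|[set P : 'M[F]_(r + d) | (P \in unitmx) && (ursubmx P == 0)]| =
    (card_unitmx F r * card_unitmx F d * #|F| ^ (d * r))%N.
Proof.
pose f (y : 'M[F]_r * 'M[F]_d * 'M[F]_(d, r)) := block_mx y.1.1 0 y.2 y.1.2.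
have f_inj : injective f.
  by move=> [[P1 P2] E] [[Q1 Q2] E'] /eq_block_mx[/= -> _ -> ->].
rewrite -[(_ ^ _)%N]card_mx -cardsT -!cardsX -(card_imset _ f_inj).
apply: eq_card => P; rewrite !inE; apply/andP/imsetP => [[P_unit /eqP P0] | [[[P1 P2] E]]].
  exists (ulsubmx P, drsubmx P, dlsubmx P); last by rewrite /f /= -P0 submxK.
  by rewrite !inE andbT !unitmxE -unitrM -(det_lblock _ (dlsubmx P)) -P0 submxK.
rewrite !inE andbT /f /= => P12 ->.
by rewrite block_mxKur eqxx !unitmxE det_lblock unitrM -!unitmxE.
Qed.

(** The lower left block is free, whence the power of [#|F|]. The parameter [R] lets one count serve
    for prescribing [Phi], [Phi] with the characteristic polynomial, or just the degree of [Phi]. *)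
Lemma card_kalman_form (F : finFieldType) (r d m : nat) (R : rel {poly F}) :
  #|[set z : 'M[F]_(r + d) * 'M[F]_(m, r + d) |
      kalman_form z && R (char_poly (drsubmx z.1)) (char_poly z.1)]| =
  (#|[set y : 'M[F]_d * ('M[F]_r * 'M[F]_(m, r)) | observable y.2.1 y.2.2
      && R (char_poly y.1) (char_poly y.2.1 * char_poly y.1)%R]| * #|F| ^ (d * r))%N.
Proof.
pose f (y : 'M[F]_d * ('M[F]_r * 'M[F]_(m, r)) * 'M[F]_(d, r)) :=
  (block_mx y.1.2.1 0 y.2 y.1.1, row_mx y.1.2.2 (0 : 'M_(m, d))).
have f_inj : injective f.
  move=> [[T [B C]] E] [[T' [B' C']] E'] [] /eq_block_mx[/= -> _ -> ->].
  by move/eq_row_mx => [-> _].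
rewrite -[(_ ^ _)%N]card_mx -cardsT -!cardsX -(card_imset _ f_inj).
apply: eq_card => z; rewrite !inE; apply/idP/imsetP => [/andP[Kz] | [[[T [B C]] E]]].
  have [z1E z2E] := kalman_formE Kz; rewrite {2}z1E char_poly_lblock => Rz.
  exists (drsubmx z.1, (ulsubmx z.1, lsubmx z.2), dlsubmx z.1).
    by rewrite !inE andbT /= Rz andbT; case/and3P: Kz.
  by rewrite /f /= -z1E -z2E; case: (z).
rewrite !inE andbT /f /= => /andP[obs RBT] -> /=.
rewrite /kalman_form /= block_mxKur block_mxKul block_mxKdr row_mxKl row_mxKr.
by rewrite !eqxx obs char_poly_lblock.
Qed.

(* Both sides count, up to the factor [#|F| ^ (d * r)], the pairs [(P, z)] such
   that [P] brings [z] to Kalman form: for fixed [z] those [P] are a coset of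
   the block triangular group. *)
Lemma card_Phi_kalman (F : finFieldType) (r d m : nat) (R : rel {poly F}) :
  (#|[set z : 'M[F]_(r + d) * 'M[F]_(m, r + d) |
      (size (Phi (col_mx z.1 z.2)) == d.+1)
      && R (Phi (col_mx z.1 z.2)) (char_poly z.1)]|
    * (card_unitmx F r * card_unitmx F d))%N =
  (card_unitmx F (r + d) *
   #|[set y : 'M[F]_d * ('M[F]_r * 'M[F]_(m, r)) | observable y.2.1 y.2.2
      && R (char_poly y.1) (char_poly y.2.1 * char_poly y.1)%R]|)%N.
Proof.
set S := [set z | _]; set Y := [set y | _].
pose K := [set z : 'M[F]_(r + d) * 'M[F]_(m, r + d) |
      kalman_form z && R (char_poly (drsubmx z.1)) (char_poly z.1)].
pose G := [set P : 'M[F]_(r + d) | P \in unitmx].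
have K_S z P : P \in unitmx -> conj_pair P z \in K -> z \in S.
  move=> P_unit; have [Pz1 z2] := conj_pairE z P_unit.
  rewrite !inE => /andP[Kw].
  rewrite -(char_poly_conj P_unit Pz1); case/and3P: (Kw) => _ _ obs.
  have [w1E w2E] := kalman_formE Kw.
  move: Pz1 z2; rewrite {1}w1E {1}w2E => Pz1 z2.
  by rewrite (Phi_kalman P_unit obs Pz1 z2) size_char_poly eqxx.
have S_K z : z \in S -> exists2 P, P \in unitmx & conj_pair P z \in K.
  rewrite inE => /andP[/eqP size_Phi].
  have [_ _] := Phi_spec z.1 z.2; rewrite size_Phi => - [Ed].
  have rankS : \rank (\sum_(i < r + d) <<z.2 *m z.1 ^+ i>>)%MS = r.
    by rewrite -(subKn (rank_leq_row _)) -Ed addnK.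
  have [P [B [E [T' [C' [P_unit obs PT defC]]]]]] := kalman_decomposition rankS.
  rewrite (Phi_kalman P_unit obs PT defC) (char_poly_conj P_unit PT) => RT.
  exists P => //; rewrite inE /conj_pair PT defC !mulmxK //= /kalman_form /=.
  by rewrite block_mxKur block_mxKul block_mxKdr row_mxKl row_mxKr !eqxx obs.
(* Right multiplication by one such [P0] maps the block triangular group onto the fiber. *)
have fiber z : z \in S ->
    #|[set P in G | conj_pair P z \in K]| =
    (card_unitmx F r * card_unitmx F d * #|F| ^ (d * r))%N.
  case/S_K=> P0 P0_unit; rewrite inE => KP0; rewrite -card_parabolic.
  rewrite -[RHS](card_imset _ (can_inj (mulmxK P0_unit))).
  apply: eq_card => P; rewrite !inE; apply/andP/imsetP => [[P_unit KP] | [Q]].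
    exists (P *m invmx P0); last by rewrite mulmxKV.
    have PP0_unit : P *m invmx P0 \in unitmx by rewrite unitmx_mul unitmx_inv P_unit.
    rewrite inE PP0_unit.
    have := conj_pairM z PP0_unit P0_unit; rewrite mulmxKV // => defP.
    have [] := conj_pairE (conj_pair P0 z) PP0_unit; rewrite -defP => Pz1 Pz2.
    case/andP: KP0 KP => Kz _ /andP[Kw _].
    by rewrite (kalman_form_parabolic Kz Kw Pz1 Pz2) eqxx.
  rewrite inE => /andP[Q_unit /eqP Q0] ->; split.
    by rewrite unitmx_mul Q_unit.
  have [Pz1 Pz2] := conj_pairE (conj_pair P0 z) Q_unit.
  case/andP: KP0 => Kz Rz.
  have [Kw Edr] := kalman_form_conj Q_unit Q0 Kz Pz1 Pz2.
  by rewrite conj_pairM // Kw Edr -(char_poly_conj Q_unit Pz1).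
(* Multiplying by this power completes the fiber size on the left and the number of Kalman forms on
   the right. *)
have q_gt0 : (0 < #|F| ^ (d * r))%N by rewrite expn_gt0 (ltnW (card_finNzRing_gt1 F)).
apply/eqP; rewrite -(eqn_pmul2r q_gt0) -mulnA -[X in _ == X]mulnA.
rewrite -card_kalman_form -/K -sum_nat_const; apply/eqP.
under eq_bigr => z Sz do rewrite -(fiber z Sz).
(* Fibers outside [S] are empty, so [z] may range over all pairs before the sums are exchanged. *)
transitivity (\sum_z #|[set P in G | conj_pair P z \in K]|).
  rewrite [RHS](bigID (mem S)) /= -[LHS]addn0; congr (_ + _)%N.
  apply/esym/big1 => z notSz.
  apply/eqP; rewrite cards_eq0 -subset0; apply/subsetP => P.
  by case/setIdP; rewrite inE => P_unit /(K_S _ _ P_unit); rewrite (negPf notSz).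
rewrite /card_unitmx -/G -sum_nat_const.
transitivity (\sum_z \sum_(P in G) nat_of_bool (conj_pair P z \in K)).
  by apply: eq_bigr => z _; rewrite -big_mkcondr sum1dep_card; apply: eq_card => P; rewrite !inE.
rewrite exchange_big; apply: eq_bigr => P; rewrite inE => P_unit.
rewrite -big_mkcond sum1dep_card -(card_preimset K (conj_pair_inj P_unit)).
by apply: eq_card => z; rewrite !inE.
Qed.

(** * Single-output pairs and matrices with given characteristic polynomial *)

Lemma expmx_char_poly (R : comNzRingType) (r : nat) (T : 'M[R]_r) :
  T ^+ r = - \sum_(j < r) (char_poly T)`_j *: T ^+ j.
Proof.
case: r T => [|r] T; first by rewrite [LHS]flatmx0 [RHS]flatmx0.
have := Cayley_Hamilton T; rewrite -{1}[char_poly T]coefK poly_def size_char_poly.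
rewrite raddf_sum /= big_ord_recr /=.
have /monicP := char_poly_monic T; rewrite /lead_coef size_char_poly /= => ->.
rewrite scale1r rmorphXn /= horner_mx_X => /eqP; rewrite addrC addr_eq0 => /eqP ->.
congr (- _); apply: eq_bigr => j _.
by rewrite linearZ rmorphXn /= horner_mx_X.
Qed.

Definition obs_mx (R : pzRingType) (r : nat) (y : 'M[R]_r * 'rV[R]_r) : 'M_r :=
  \matrix_i (y.2 *m y.1 ^+ i).

(** The first unit row; comparing in [nat] lets it make sense for [r = 0] as well. *)
Definition row_e0 (R : pzRingType) (r : nat) : 'rV[R]_r := \row_j (j == 0 :> nat)%:R.

Lemma row_e0_obs_mx (R : pzRingType) (r : nat) (y : 'M[R]_r * 'rV[R]_r) :
  row_e0 R r *m obs_mx y = y.2.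
Proof.
case: r y => [|r] y; first by rewrite [LHS]thinmx0 [RHS]thinmx0.
have -> : row_e0 R r.+1 = delta_mx 0 0.
  by apply/rowP => j; rewrite !mxE.
by rewrite -rowE rowK expr0 mulmx1.
Qed.

(** The companion matrix shifts unit rows: its observability matrix with output [row_e0] is the
    identity. *)
Lemma row_e0_companion (R : nzRingType) (g : {poly R}) (i : 'I_(size g).-1) :
  row_e0 R (size g).-1 *m companionmx g ^+ i = delta_mx 0 i.
Proof.
case: i => i; elim: i => [|i IHi] lt_i.
  by rewrite expr0 mulmx1; apply/rowP => j; rewrite !mxE.
rewrite exprSr -[_ * _]/(_ *m _) mulmxA (IHi (ltnW lt_i)) -rowE.
apply/rowP => j; rewrite !mxE /= ltn_eqF; last by rewrite -ltnS prednK // (leq_ltn_trans _ lt_i).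
by rewrite -val_eqE /= eq_sym.
Qed.

(** Multiplication by [y.1] moves each row of [obs_mx y] to the next; at the last row
    Cayley-Hamilton supplies the coefficients of [g]. *)
Lemma obs_mx_companion (R : comNzRingType) (g : {poly R})
    (y : 'M[R]_((size g).-1) * 'rV[R]_((size g).-1)) :
  char_poly y.1 = g -> obs_mx y *m y.1 = companionmx g *m obs_mx y.
Proof.
move=> char_y; apply/row_matrixP => i; rewrite !row_mul rowK.
rewrite -mulmxA -[y.1 ^+ i *m y.1]exprSr.
have [Ei | ne_i] := eqVneq (i : nat) (size g).-1.-1.
  have -> : i.+1 = (size g).-1 by move: (ltn_predK (ltn_ord i)); rewrite -Ei.
  rewrite expmx_char_poly char_y mulmxN mulmx_sumr mulmx_sum_row -sumrN.
  apply: eq_bigr => j _; rewrite -scalemxAr rowK !mxE Ei eqxx.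
  by rewrite scaleNr.
have lt_i : (i.+1 < (size g).-1)%N.
  by rewrite ltn_neqAle ltn_ord andbT; apply: contra_neq ne_i => /(congr1 predn).
have -> : row i (companionmx g) = delta_mx 0 (Ordinal lt_i).
  by apply/rowP => j; rewrite !mxE (negPf ne_i) -val_eqE /= eq_sym.
by rewrite -rowE rowK.
Qed.

(* [obs_mx] is a bijection onto the invertible matrices, because it conjugates
   [y.1] to the companion matrix of its characteristic polynomial. *)
Lemma card_observable1 (F : finFieldType) (g : {poly F}) :
  g \is monic ->
  #|[set y : 'M[F]_((size g).-1) * 'rV[F]_((size g).-1) |
      observable y.1 y.2 && (char_poly y.1 == g)]| = card_unitmx F (size g).-1.
Proof.
move=> g_mon; set Y := [set y | _].
have obs_unit y : observable y.1 y.2 -> obs_mx y \in unitmx.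
  move/observableP => obs; rewrite -row_full_unit.
  suff /eqP : cokermx (obs_mx y) = 0.
    by rewrite -mxrank_eq0 mxrank_coker subn_eq0 -col_leq_rank.
  apply: obs => i; move: i; apply: mul_expmx_eq0 => i.
  by have := mulmx_coker (obs_mx y) => /(congr1 (row i)); rewrite row_mul rowK row0.
have obs_inj : {in Y &, injective (@obs_mx F (size g).-1)}.
  move=> y y'; rewrite !inE => /andP[/obs_unit W_unit /eqP cy] /andP[_ /eqP cy'] eqW.
  have E2 : y.2 = y'.2 by rewrite -!row_e0_obs_mx eqW.
  have E1 : y.1 = y'.1.
    apply: (can_inj (mulKmx W_unit)); rewrite (obs_mx_companion cy) eqW.
    by rewrite (obs_mx_companion cy').
  by case: y y' E1 E2 {cy cy' eqW W_unit} => [? ?] [? ?] /= -> ->.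
rewrite -(card_in_imset obs_inj); apply: eq_card => W; rewrite inE.
apply/imsetP/idP => [[y] | W_unit]; first by rewrite inE => /andP[/obs_unit ? _] ->.
(* Surjectivity: the companion pair conjugated by [W] has observability matrix [W]. *)
have [y [y1 y2]] : exists y : 'M[F]_((size g).-1) * 'rV[F]_((size g).-1),
    y.1 = invmx W *m companionmx g *m W /\ y.2 = row_e0 F (size g).-1 *m W.
  by exists (invmx W *m companionmx g *m W, row_e0 F (size g).-1 *m W).
have WT : W *m y.1 = companionmx g *m W by rewrite y1 !mulmxA mulmxV // mul1mx.
have Wi i : y.2 *m y.1 ^+ i = row_e0 F (size g).-1 *m companionmx g ^+ i *m W.
  elim: i => [|i IHi]; first by rewrite !expr0 !mulmx1.
  by rewrite !exprSr !mulmxA IHi -!mulmxA WT.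
have defW : W = obs_mx y.
  by apply/row_matrixP => i; rewrite rowK Wi row_e0_companion -rowE.
exists y => //; rewrite inE (char_poly_conj W_unit WT) companionmxK // eqxx andbT.
apply/observableP => p V yV; suff WV0 : W *m V = 0.
  by rewrite -[V](mulKmx W_unit) WV0 mulmx0.
by apply/row_matrixP => i; rewrite defW row_mul rowK row0 yV.
Qed.

Lemma card_unitmx_gt0 (F : finFieldType) (n : nat) : (0 < card_unitmx F n)%N.
Proof. by apply/card_gt0P; exists 1%:M; rewrite inE unitmx1. Qed.

Definition card_char_poly (F : finFieldType) (f : {poly F}) :=
  #|[set T : 'M[F]_((size f).-1) | char_poly T == f]|.

(** By orbit-stabilizer, the sum of inverse centralizer orders over the conjugacy classes with
    characteristic polynomial [f]. *)
Definition char_weight (F : finFieldType) (f : {poly F}) : rat :=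
  (card_char_poly f)%:R / (card_unitmx F (size f).-1)%:R.

(** The observable part has characteristic polynomial [g]; by [card_observable1] such pairs are as
    many as the invertible matrices of that size, and this factor cancels. *)
Lemma card_Phi_char (F : finFieldType) (k : nat) (f h : {poly F}) :
  f \is monic -> h \is monic -> h %| f -> k = (size f).-1 ->
  (#|[set z : 'M[F]_k * 'rV[F]_k |
      (Phi (col_mx z.1 z.2) == h) && (char_poly z.1 == f)]|)%:R =
    (card_unitmx F k)%:R * char_weight h :> rat.
Proof.
move=> f_mon h_mon h_f; pose g := f %/ h.
have def_f : f = g * h by rewrite divpK.
have g_mon : g \is monic by move: f_mon; rewrite def_f monicMr.
have -> : (size f).-1 = ((size g).-1 + (size h).-1)%N.
  rewrite def_f size_mul ?monic_neq0 //.
  move: (monic_neq0 g_mon) (monic_neq0 h_mon); rewrite -!size_poly_gt0.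
  by case: (size g) (size h) => // a [] // b _ _; rewrite addSn addnS.
move=> Ek; subst k.
have := card_Phi_kalman (size g).-1 (size h).-1 1 (fun u v => (u == h) && (v == f)).
set S := [set z | _]; set Y := [set y | _].
set S' := [set z | _].
have -> : S = S'.
  apply/setP => z; rewrite !inE andbA; congr (_ && _).
  case: (eqVneq (Phi _) h) => [->|]; last by rewrite andbF.
  by rewrite prednK ?eqxx // size_poly_gt0 monic_neq0.
have -> : #|Y| = (card_char_poly h * card_unitmx F (size g).-1)%N.
  rewrite -(card_observable1 g_mon) -cardsX; apply: eq_card => - [T [B C]].
  rewrite !inE /= andbCA; case: eqP => [->|_] /=; rewrite ?andbF //.
  by rewrite def_f (inj_eq (mulIf (monic_neq0 h_mon))).
move/(congr1 (fun n : nat => n%:R : rat)); rewrite !natrM /char_weight => E.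
have g0 : (card_unitmx F (size g).-1)%:R != 0 :> rat by rewrite pnatr_eq0 -lt0n card_unitmx_gt0.
have h0 : (card_unitmx F (size h).-1)%:R != 0 :> rat by rewrite pnatr_eq0 -lt0n card_unitmx_gt0.
apply: (mulIf g0); apply: (mulIf h0); rewrite -[LHS]mulrA E.
by rewrite -!mulrA; congr (_ * (_ * _)); rewrite mulrCA mulVf ?mulr1.
Qed.

(** Each [T] with characteristic polynomial [f] is paired with every output row, and the pairs are
    sorted by [Phi], a monic divisor of [f]. *)
Lemma char_weight_rec (F : finFieldType) (f : {poly F}) (L : seq {poly F}) :
  f \is monic -> uniq L ->
  (forall h, (h \in L) = (h \is monic) && (h %| f)) ->
  (#|F|%:R ^+ (size f).-1) * char_weight f = \sum_(h <- L) char_weight h.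
Proof.
move=> f_mon L_uniq LE; set k := (size f).-1.
have k0 : (card_unitmx F k)%:R != 0 :> rat by rewrite pnatr_eq0 -lt0n card_unitmx_gt0.
have Ew : (card_unitmx F k)%:R * char_weight f = (card_char_poly f)%:R.
  by rewrite /char_weight mulrC divfK.
apply: (mulfI k0); rewrite mulrCA Ew mulr_sumr.
pose N h := #|[set z : 'M[F]_k * 'rV[F]_k |
      (Phi (col_mx z.1 z.2) == h) && (char_poly z.1 == f)]|.
rewrite big_seq (eq_bigr (fun h => (N h)%:R)); last first.
  by move=> h; rewrite LE => /andP[h_mon h_f]; rewrite card_Phi_char.
rewrite -big_seq -natr_sum -natrX -natrM; congr (_%:R).
have -> : (#|F| ^ k)%N = #|[set: 'rV[F]_k]| by rewrite cardsT card_mx mul1n.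
rewrite mulnC -cardsX -sum1_card.
transitivity (\sum_(z in setX [set T : 'M[F]_k | char_poly T == f] [set: 'rV[F]_k])
    \sum_(h <- L) nat_of_bool (Phi (col_mx z.1 z.2) == h)).
  apply: eq_bigr => z; rewrite !inE andbT => /eqP char_z.
  have [Phi_mon Phi_dvd _] := Phi_spec z.1 z.2.
  rewrite char_z in Phi_dvd.
  have : Phi (col_mx z.1 z.2) \in L by rewrite LE Phi_mon.
  rewrite -big_mkcond sum1_count -/(count _ _) => Phi_L.
  by rewrite (eq_count (a2 := pred1 (Phi (col_mx z.1 z.2)))) ?count_uniq_mem ?Phi_L //.
rewrite exchange_big; apply: eq_bigr => h _.
rewrite -big_mkcondr sum1dep_card; apply: eq_card => z; rewrite !inE andbT.
by rewrite andbC.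
Qed.

(** * Monic divisors of a factored polynomial *)

(** Indexes the monic divisors of a factored polynomial; zero exponents are kept so that all members
    share the same [map fst]. *)
Definition subexponents (T : Type) (s : seq (T * nat)) : seq (seq (T * nat)) :=
  foldr (fun pe L => [seq (pe.1, j) :: u | j <- iota 0 pe.2.+1, u <- L]) [:: [::]] s.

Definition factor_prod (R : comNzRingType) (s : seq (R * nat)) : R :=
  \prod_(pe <- s) pe.1 ^+ pe.2.

Definition monic_irreducible (F : fieldType) (s : seq ({poly F} * nat)) :=
  forall p, p \in map fst s -> p \is monic /\ irreducible_poly p.

Lemma subexponents_consP (T : eqType) (p : T) (e : nat) (s u : seq (T * nat)) :
  reflect (exists j v, [/\ (j <= e)%N, v \in subexponents s & u = (p, j) :: v])
          (u \in subexponents ((p, e) :: s)).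
Proof.
apply: (iffP allpairsPdep) => -[j [v []]].
  by rewrite mem_iota ltnS => le_je v_s ->; exists j, v.
by move=> le_je v_s ->; exists j, v; rewrite mem_iota ltnS.
Qed.

Lemma mem_subexponents_refl (T : eqType) (s : seq (T * nat)) : s \in subexponents s.
Proof.
by elim: s => // -[p e] s IHs; apply/subexponents_consP; exists e, s.
Qed.

Lemma subexponents_fst (T : eqType) (s u : seq (T * nat)) :
  u \in subexponents s -> map fst u = map fst s.
Proof.
elim: s u => [|[p e] s IHs] u; first by rewrite inE => /eqP->.
by case/subexponents_consP => j [v [_ /IHs vs ->]] /=; rewrite vs.
Qed.

Lemma subexponents_uniq (T : eqType) (s : seq (T * nat)) : uniq (subexponents s).
Proof.
elim: s => // -[p e] s IHs; apply: allpairs_uniq => //; first exact: iota_uniq.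
by move=> [i u] [j v] _ _ /= [-> ->].
Qed.

Lemma sum_subexponents (T : Type) (R : comNzRingType) (U : T -> nat -> R) (s : seq (T * nat)) :
  \sum_(u <- subexponents s) \prod_(pe <- u) U pe.1 pe.2
  = \prod_(pe <- s) \sum_(j < pe.2.+1) U pe.1 j.
Proof.
elim: s => [|[p e] s IHs]; first by rewrite [subexponents _]/= big_seq1 !big_nil.
rewrite [LHS]big_allpairs_dep big_cons -IHs big_distrl -(big_mkord predT (fun j => U p j * _)) /=.
rewrite /index_iota subn0; apply: eq_bigr => j _; rewrite mulr_sumr.
by apply: eq_bigr => u _; rewrite big_cons.
Qed.

Lemma coprimep_factor_prod (F : fieldType) (p : {poly F}) (s : seq ({poly F} * nat)) :
  p \is monic -> irreducible_poly p -> p \notin map fst s -> monic_irreducible s ->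
  coprimep p (factor_prod s).
Proof.
move=> p_mon p_irr; rewrite /factor_prod; elim: s => [|[r e] s IHs].
  by rewrite big_nil coprimep1.
rewrite inE negb_or big_cons => /andP[/= ne_pr pNs] s_irr.
rewrite coprimepMr IHs // ?andbT; last by move=> p' p's; apply: s_irr; rewrite inE p's orbT.
apply: coprimep_expr.
have [r_mon r_irr] : r \is monic /\ irreducible_poly r by apply: s_irr; rewrite inE eqxx.
rewrite irreducible_poly_coprime //; apply: contra ne_pr => p_r.
rewrite -eqp_monic //; apply: r_irr.2 p_r.
by rewrite gtn_eqF //; case: p_irr.
Qed.

Lemma monic_factor_prod (F : fieldType) (s : seq ({poly F} * nat)) :
  monic_irreducible s -> factor_prod s \is monic.
Proof.
move=> s_irr; rewrite /factor_prod big_seq; apply: monic_prod => pe pe_s.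
by apply: monic_exp; have [] := s_irr pe.1 (map_f _ pe_s).
Qed.

(** Induction on [e]: either [p] divides [h] and is cancelled, or [h] is coprime to [p] and Gauss's
    lemma drops the power. *)
Lemma dvdp_exp_mul_split (F : fieldType) (p V h : {poly F}) (e : nat) :
  p \is monic -> irreducible_poly p -> h \is monic -> h %| p ^+ e * V ->
  exists j h', [/\ (j <= e)%N, h' \is monic, h' %| V & h = p ^+ j * h'].
Proof.
move=> p_mon p_irr; elim: e h => [|e IHe] h h_mon h_dvd.
  by exists 0%N, h; rewrite !expr0 !mul1r in h_dvd *.
have [p_h | pNh] := boolP (p %| h); last first.
  exists 0%N, h; split=> //; last by rewrite mul1r.
  move: h_dvd; rewrite Gauss_dvdpr // coprimep_sym coprimep_pexpl //.
  by rewrite irreducible_poly_coprime.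
have def_h : h = p * (h %/ p) by rewrite mulrC divpK.
have q_mon : h %/ p \is monic by move: h_mon; rewrite {1}def_h monicMl.
have [|j [h' [le_je h'_mon h'_V E]]] := IHe _ q_mon.
  by move: h_dvd; rewrite {1}def_h exprS -mulrA dvdp_mul2l ?monic_neq0.
by exists j.+1, h'; split=> //; rewrite def_h E mulrA -exprS.
Qed.

(** With [factor_prod_inj], this provides the duplicate-free list of divisors for
    [char_weight_rec]. *)
Lemma mem_factor_prod_subexponents (F : fieldType) (s : seq ({poly F} * nat)) (h : {poly F}) :
  monic_irreducible s ->
  (h \in map (@factor_prod _) (subexponents s)) = (h \is monic) && (h %| factor_prod s).
Proof.
rewrite /factor_prod; elim: s h => [|[p e] s IHs] h s_irr.
  rewrite /= !big_nil inE dvdp1; apply/eqP/andP => [->|[h_mon]].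
    by rewrite monic1 size_poly1.
  by rewrite size_poly_eq1 eqp_monic ?monic1 // => /eqP.
have [p_mon p_irr] : p \is monic /\ irreducible_poly p by apply: s_irr; rewrite inE eqxx.
have s_irr' : monic_irreducible s by move=> p' p's; apply: s_irr; rewrite inE p's orbT.
rewrite big_cons; apply/mapP/andP => [[u /subexponents_consP[j [v [le_je v_s ->]]] ->]|].
  have: factor_prod v \in map (@factor_prod _) (subexponents s) by apply: map_f.
  rewrite IHs // big_cons => /andP[v_mon v_dvd] /=.
  split; first by rewrite monicMl // monic_exp.
  apply: dvdp_mul => //; exact: dvdp_exp2l.
case=> h_mon /(dvdp_exp_mul_split p_mon p_irr h_mon)[j [h' [le_je h'_mon h'_dvd ->]]].
have: h' \in map (@factor_prod _) (subexponents s) by rewrite IHs // h'_mon.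
case/mapP => v v_s ->; exists ((p, j) :: v); last by rewrite big_cons.
by apply/subexponents_consP; exists j, v.
Qed.

Lemma exp_mul_coprime_inj (F : fieldType) (p v w : {poly F}) (i j : nat) :
  irreducible_poly p -> coprimep p v -> coprimep p w ->
  p ^+ i * v = p ^+ j * w -> i = j /\ v = w.
Proof.
move=> p_irr; have p0 : p != 0 by rewrite irredp_neq0.
have pN1 : ~~ (size p == 1%N) by rewrite gtn_eqF //; case: p_irr.
elim: i j => [|i IHi] [|j] pv pw; rewrite ?expr0 ?mul1r.
- by [].
- by move=> Ev; rewrite Ev exprS -mulrA coprimepMr coprimepp (negPf pN1) in pv.
- by move=> Ew; rewrite -Ew exprS -mulrA coprimepMr coprimepp (negPf pN1) in pw.
by rewrite !exprS -!mulrA => /(mulfI p0)/IHi[] // -> ->.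
Qed.

Lemma factor_prod_inj (F : fieldType) (s : seq ({poly F} * nat)) :
  uniq (map fst s) -> monic_irreducible s ->
  {in subexponents s &, injective (@factor_prod {poly F})}.
Proof.
elim: s => [|[p e] s IHs]; first by move=> _ _ u v; rewrite !inE => /eqP-> /eqP->.
case/andP=> pNs s_uniq s_irr u v.
have [p_mon p_irr] : p \is monic /\ irreducible_poly p by apply: s_irr; rewrite inE eqxx.
have s_irr' : monic_irreducible s by move=> p' p's; apply: s_irr; rewrite inE p's orbT.
case/subexponents_consP=> i [u' [_ u's ->]] /subexponents_consP[j [v' [_ v's ->]]].
have cop w : w \in subexponents s -> coprimep p (factor_prod w).
  move=> /subexponents_fst Ew; apply: coprimep_factor_prod; rewrite ?Ew //.
  by move=> p'; rewrite Ew; apply: s_irr'.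
rewrite /factor_prod !big_cons /=.
by case/(exp_mul_coprime_inj p_irr (cop _ u's) (cop _ v's)) => -> /IHs->.
Qed.

(** * Weights and q-binomial identities *)

Lemma FqS (q : rat) (n : nat) : Fq q n.+1 = Fq q n * (1 - q ^- n.+1).
Proof. by rewrite /Fq big_ord_recr. Qed.

Lemma expr_inv_neq1 (q : rat) (n : nat) : 1 < q -> 1 - q ^- n.+1 != 0.
Proof.
move=> q_gt1; rewrite subr_eq0 eq_sym invr_eq1 -subr_eq0.
by rewrite subr_eq0 gt_eqF // exprn_egt1.
Qed.

Lemma Fq_neq0 (q : rat) (n : nat) : 1 < q -> Fq q n != 0.
Proof. by move=> q_gt1; apply/prodf_neq0 => i _; apply: expr_inv_neq1. Qed.

(** The recursion of [char_weight_rec] at a prime power; the right side is left unsimplified to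
    display the last summand times [Q ^+ e]. *)
Lemma sum_weight_prime (Q : rat) (e : nat) : 1 < Q ->
  \sum_(j < e.+1) Q ^- j / Fq Q j = Q ^+ e * (Q ^- e / Fq Q e).
Proof.
move=> Q_gt1; have Q0 : Q != 0 by rewrite gt_eqF // (lt_trans ltr01).
elim: e => [|e IHe]; first by rewrite big_ord1 !expr0 mul1r.
rewrite big_ord_recr /= IHe !mulVKf ?expf_neq0 // FqS.
have F0 := Fq_neq0 e Q_gt1; have D0 := expr_inv_neq1 e Q_gt1.
move: (Fq Q e) F0 (Q ^- e.+1) D0 => x x0 y y1; field.
by rewrite y1.
Qed.

Definition prime_weight (F : finFieldType) (p : {poly F}) (e : nat) : rat :=
  let Q : rat := #|F|%:R ^+ (size p).-1 in Q ^- e / Fq Q e.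

Lemma card_finField_gt1 (F : finFieldType) : 1 < #|F|%:R :> rat.
Proof. by rewrite -[1]/(1%:R) ltr_nat card_finNzRing_gt1. Qed.

Lemma size_factor_prod (F : fieldType) (s : seq ({poly F} * nat)) :
  monic_irreducible s ->
  (size (factor_prod s)).-1 = (\sum_(pe <- s) (size pe.1).-1 * pe.2)%N.
Proof.
rewrite /factor_prod; elim: s => [|[p e] s IHs] s_irr; first by rewrite !big_nil size_poly1.
have [p_mon p_irr] : p \is monic /\ irreducible_poly p by apply: s_irr; rewrite inE eqxx.
have s_irr' : monic_irreducible s by move=> p' p's; apply: s_irr; rewrite inE p's orbT.
rewrite !big_cons /= -IHs // -size_exp size_mul ?monic_neq0 ?monic_exp ?monic_factor_prod //.
have : (0 < size (p ^+ e))%N by rewrite size_poly_gt0 monic_neq0 // monic_exp.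
have := monic_neq0 (monic_factor_prod s_irr'); rewrite /factor_prod -size_poly_gt0.
by case: (size _) => // a _; case: (size _) => // b _; rewrite addnS.
Qed.

(** Both sides satisfy the recursion of [char_weight_rec], which in positive degree determines a
    weight from those of the proper divisors. *)
Lemma char_weight_factor_prod (F : finFieldType) (s : seq ({poly F} * nat)) :
  uniq (map fst s) -> monic_irreducible s ->
  char_weight (factor_prod s) = \prod_(pe <- s) prime_weight pe.1 pe.2.
Proof.
have [N] := ubnP (size (factor_prod s)); elim: N s => // N IHN s lt_s s_uniq s_irr.
have q_gt1 := card_finField_gt1 F.
have s_mon := monic_factor_prod s_irr; set f := factor_prod s in s_mon *.
set q : rat := #|F|%:R in q_gt1 *.
have deg_f := size_factor_prod s_irr; rewrite -/f in deg_f.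
(* Exponents may be zero here, so degree zero means that all of them vanish, not that [s] is
   empty. *)
have [d0|d_gt0] := posnP (size f).-1.
  rewrite [RHS]big_seq big1 => [|pe pe_s]; last first.
    have [_ [p_size _]] := s_irr _ (map_f fst pe_s).
    move: deg_f; rewrite d0 (big_rem pe) //= => /esym/eqP; rewrite addn_eq0 muln_eq0.
    case/andP => /orP[|/eqP-> _]; last by rewrite /prime_weight /Fq big_ord0 expr0 invr1 mulr1.
    by rewrite -subn1 subn_eq0 leqNgt p_size.
  have -> : f = 1.
    by apply/eqP; rewrite -eqp_monic ?monic1 // -size_poly_eq1 (polySpred (monic_neq0 s_mon)) d0.
  rewrite /char_weight /card_char_poly size_poly1 /=.
  have -> : #|[set T : 'M[F]_0 | char_poly T == 1]| = card_unitmx F 0.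
    by apply: eq_card => T; rewrite !inE /char_poly !unitmxE !det_mx00 unitr1 eqxx.
  by rewrite divff // pnatr_eq0 -lt0n card_unitmx_gt0.
have L_uniq : uniq (map (@factor_prod _) (subexponents s)).
  by rewrite map_inj_in_uniq ?subexponents_uniq //; exact: factor_prod_inj.
have := char_weight_rec s_mon L_uniq (fun h => mem_factor_prod_subexponents h s_irr).
rewrite big_map -/q.
(* Expanding the Euler product reduces the recursion to prime powers. *)
have sum_U : \sum_(u <- subexponents s) \prod_(pe <- u) prime_weight pe.1 pe.2
   = q ^+ (size f).-1 * \prod_(pe <- s) prime_weight pe.1 pe.2.
  rewrite sum_subexponents deg_f -prodrXr -big_split big_seq [RHS]big_seq.
  apply: eq_bigr => pe pe_s; rewrite sum_weight_prime ?exprM //.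
  have [_ [p_size _]] := s_irr _ (map_f fst pe_s).
  by rewrite exprn_egt1 // -lt0n -subn1 subn_gt0.
rewrite (bigD1_seq s) ?mem_subexponents_refl ?subexponents_uniq //=.
move: sum_U; rewrite (bigD1_seq s) ?mem_subexponents_refl ?subexponents_uniq //=.
(* Induction applies since a monic divisor of the same size is [f] itself, which forces [u = s]. *)
have -> : \sum_(u <- subexponents s | u != s) char_weight (factor_prod u)
   = \sum_(u <- subexponents s | u != s) \prod_(pe <- u) prime_weight pe.1 pe.2.
  rewrite big_seq_cond [RHS]big_seq_cond; apply: eq_bigr => u /andP[u_s ne_us].
  have u_fst := subexponents_fst u_s.
  apply: IHN; rewrite ?u_fst //; last by move=> p; rewrite u_fst; apply: s_irr.
  have := map_f (@factor_prod _) u_s; rewrite mem_factor_prod_subexponents // => /andP[u_mon u_dvd].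
  rewrite -ltnS; apply: leq_trans lt_s; rewrite ltnS ltn_neqAle.
  rewrite (dvdp_leq (monic_neq0 s_mon) u_dvd) andbT.
  apply: contraNneq ne_us => eq_size; apply/eqP.
  apply: (factor_prod_inj s_uniq s_irr u_s (mem_subexponents_refl _)).
  by apply/eqP; rewrite -eqp_monic // -dvdp_size_eqp ?eq_size.
move: (\sum_(u <- _ | _) _) (\prod_(pe <- s) _) (char_weight _) => A U w EU Ew.
have qd1 : q ^+ (size f).-1 - 1 != 0.
  by rewrite subr_eq0 gt_eqF // exprn_egt1 // -lt0n.
apply: (mulfI qd1); rewrite !mulrBl !mul1r Ew -EU; ring.
Qed.

Lemma natr_card_unitmx (F : finFieldType) (n : nat) :
  (card_unitmx F n)%:R = #|F|%:R ^+ (n * n) * Fq #|F|%:R n :> rat.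
Proof.
have q_gt1 := card_finField_gt1 F; set q : rat := #|F|%:R in q_gt1 *.
have q0 : q != 0 by rewrite gt_eqF // (lt_trans ltr01).
have -> : (card_unitmx F n)%:R = q ^+ 'C(n, 2) * \prod_(i < n) (q ^+ i.+1 - 1) :> rat.
  case: n => [|n].
    rewrite /Fq !big_ord0 expr0 mulr1.
    have -> : card_unitmx F 0 = #|[set: 'M[F]_0]|.
      by apply: eq_card => T; rewrite !inE unitmxE det_mx00 unitr1.
    by rewrite cardsT card_mx.
  have -> : card_unitmx F n.+1 = #|'GL_n.+1[F]%g|.
    by rewrite cardsT card_sub /card_unitmx cardsE.
  rewrite card_GL // natrM natrX big_add1 big_mkord natr_prod; congr (_ * _).
  apply: eq_bigr => i _; rewrite natrB ?natrX // expn_gt0.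
  by rewrite (ltnW (card_finNzRing_gt1 F)).
elim: n => [|n IHn]; first by rewrite /Fq !big_ord0 !expr0.
have Dq : q ^+ n.+1 - 1 = q ^+ n.+1 * (1 - q ^- n.+1).
  by rewrite mulrBr mulr1 mulfV ?expf_neq0.
rewrite big_ord_recr /= FqS binS bin1 exprD mulrACA IHn Dq mulnSr mulSnr !exprD.
move: (Fq q n) (1 - _) => x y; ring.
Qed.

(* The Gaussian binomial coefficients in base [t], by Pascal's rule. *)
Fixpoint gauss_binom (t : rat) (n k : nat) : rat :=
  match n, k with
  | _, 0 => 1
  | 0, _.+1 => 0
  | n.+1, k.+1 => gauss_binom t n k + t ^+ k.+1 * gauss_binom t n k.+1
  end.

Lemma gauss_binom0 (t : rat) (n : nat) : gauss_binom t n 0 = 1.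
Proof. by case: n. Qed.

Lemma gauss_binom_small (t : rat) (n k : nat) : (n < k)%N -> gauss_binom t n k = 0.
Proof.
elim: n k => [|n IHn] [|k] //= lt_nk.
by rewrite !IHn ?mulr0 ?addr0 // ltnW.
Qed.

(** With [a = q ^- k.+1] and [b = q ^- (n - k)], Pascal's rule reduces to
    [(1 - a) + a (1 - b) = 1 - a b]. *)
Lemma gauss_binomE (q : rat) (n k : nat) : (k <= n)%N ->
  gauss_binom q^-1 n k * (Fq q k * Fq q (n - k)) = Fq q n.
Proof.
elim: n k => [|n IHn] [|k] // le_kn; first by rewrite /Fq !big_ord0 !mul1r.
  by rewrite gauss_binom0 /Fq big_ord0 !mul1r subn0.
rewrite /= subSS mulrDl FqS exprVn.
have -> : gauss_binom q^-1 n k * (Fq q k * (1 - q ^- k.+1) * Fq q (n - k))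
  = Fq q n * (1 - q ^- k.+1).
  by rewrite -(IHn k) //; move: (gauss_binom _ _ _) (Fq _ _) => a b; ring.
have [lt_kn|] := ltnP k n; last first.
  move=> le_nk; have -> : n = k by apply/eqP; rewrite eqn_leq le_nk -ltnS.
  by rewrite gauss_binom_small // !(mulr0, mul0r) addr0 FqS.
have -> : (n - k)%N = (n - k.+1).+1 by rewrite subnSK.
rewrite [Fq q (n - k.+1).+1]FqS.
have -> : q ^- k.+1 * gauss_binom q^-1 n k.+1 *
    (Fq q k * (1 - q ^- k.+1) * (Fq q (n - k.+1) * (1 - q ^- (n - k.+1).+1)))
  = q ^- k.+1 * (1 - q ^- (n - k.+1).+1) * Fq q n.
  rewrite -(IHn k.+1) // FqS; move: (gauss_binom _ _ _) (Fq _ _) (Fq _ _) => a b c; ring.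
rewrite FqS; have -> : q ^- n.+1 = q ^- k.+1 * q ^- (n - k.+1).+1.
  by rewrite -invfM -exprD addnS subnKC.
move: (Fq _ _) (q ^- _) (q ^- _) => a b c; ring.
Qed.

(* Newton interpolation of [z ^+ k] at the nodes [1, t, t ^+ 2], etc. *)
Lemma gauss_binom_sum (t z : rat) (k : nat) :
  \sum_(r < k.+1) gauss_binom t k r * \prod_(j < r) (z - t ^+ j) = z ^+ k.
Proof.
elim: k => [|k IHk]; first by rewrite big_ord1 big_ord0 mulr1.
pose P r := \prod_(j < r) (z - t ^+ j).
have PS r : P r.+1 = P r * (z - t ^+ r) by rewrite /P big_ord_recr.
rewrite big_ord_recl gauss_binom0 /= big_ord0 mulr1.
under eq_bigr do rewrite mulrDl.
rewrite big_split /= addrCA exprS -IHk mulr_sumr.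
(* The isolated [1] is the term of index 0 of the shifted sum; then
   [P i.+1 + t ^+ i * P i = z * P i]. *)
have -> : 1 + \sum_(i < k.+1) t ^+ i.+1 * gauss_binom t k i.+1 * P i.+1
  = \sum_(i < k.+1) t ^+ i * gauss_binom t k i * P i.
  rewrite big_ord_recr /= gauss_binom_small // mulr0 mul0r addr0.
  by rewrite [RHS]big_ord_recl /= gauss_binom0 /P big_ord0 !mulr1.
rewrite -big_split; apply: eq_bigr => i _ /=.
by rewrite -/(P _) -/(P _) PS; ring.
Qed.

(** The induction trades [d] for [r] with [r + d] fixed, so that [qbinom] gains just one factor. *)
Lemma qbinomE (q : rat) (r d : nat) : 1 < q ->
  qbinom q (r + d) d * (Fq q d * Fq q r) = q ^+ (d * r) * Fq q (r + d).
Proof.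
move=> q_gt1; have q0 : q != 0 by rewrite gt_eqF // (lt_trans ltr01).
have Dq n : q ^+ n.+1 - 1 = q ^+ n.+1 * (1 - q ^- n.+1).
  by rewrite mulrBr mulr1 mulfV ?expf_neq0.
elim: d r => [|d IHd] r; first by rewrite mul0n expr0 addn0 /qbinom /Fq !big_ord0 !mul1r.
rewrite /qbinom big_ord_recr /= addnS -addSn -/(qbinom q (r.+1 + d) d).
rewrite addnK !Dq.
have D0 := expr_inv_neq1 d q_gt1.
have qd0 : q ^+ d.+1 != 0 by rewrite expf_neq0.
rewrite FqS.
transitivity (qbinom q (r.+1 + d) d * (Fq q d * Fq q r.+1) * (q ^+ r.+1 / q ^+ d.+1)).
  rewrite FqS; move: (qbinom _ _ _) (Fq q d) (Fq q r) => u v w.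
  have a1 : q ^+ d.+1 - 1 != 0 by rewrite Dq mulf_neq0.
  have b0 : q ^+ r.+1 != 0 by rewrite expf_neq0.
  move: (q ^+ d.+1) qd0 a1 (q ^+ r.+1) b0 => a a0 a1 b b0.
  by field; rewrite a0 b0.
rewrite IHd mulrAC; congr (_ * _).
by rewrite mulrA -exprD -mulSnr mulnSr exprD mulfK.
Qed.

(** * Counting observable pairs *)

Definition card_observable (F : finFieldType) (r m : nat) :=
  #|[set y : 'M[F]_r * 'M[F]_(m, r) | observable y.1 y.2]|.

Lemma card_Phi_eq (F : finFieldType) (r m : nat) (f : {poly F}) : f \is monic ->
  (#|[set z : 'M[F]_(r + (size f).-1) * 'M[F]_(m, r + (size f).-1) |
      Phi (col_mx z.1 z.2) == f]|
    * (card_unitmx F r * card_unitmx F (size f).-1))%N =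
  (card_unitmx F (r + (size f).-1) * (card_char_poly f * card_observable F r m))%N.
Proof.
move=> f_mon; have := card_Phi_kalman r (size f).-1 m (fun h _ => h == f).
set S := [set z | _]; set Y := [set y | _] => E.
have -> : [set z | Phi (col_mx z.1 z.2) == f] = S.
  apply/setP => z; rewrite !inE; have [->|] := eqVneq (Phi _) f; last by rewrite andbF.
  by rewrite prednK ?eqxx // size_poly_gt0 monic_neq0.
rewrite E; congr (_ * _)%N; rewrite -cardsX; apply: eq_card => y.
by rewrite !inE andbC.
Qed.

(** With only the degree of [Phi] prescribed, the unobservable block is an arbitrary square
    matrix. *)
Lemma card_Phi_size (F : finFieldType) (k r d m : nat) : k = (r + d)%N ->
  (#|[set z : 'M[F]_k * 'M[F]_(m, k) | size (Phi (col_mx z.1 z.2)) == d.+1]|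
    * (card_unitmx F r * card_unitmx F d))%N =
  (card_unitmx F k * (#|F| ^ (d * d) * card_observable F r m))%N.
Proof.
move=> ->.
rewrite (eq_card (B := [set z : 'M[F]_(r + d) * 'M[F]_(m, r + d) |
    (size (Phi (col_mx z.1 z.2)) == d.+1) && true])); last first.
  by move=> z; rewrite !inE andbT.
rewrite (card_Phi_kalman r d m (fun _ _ => true)); congr (_ * _)%N.
by rewrite -card_mx -cardsT -cardsX; apply: eq_card => y; rewrite !inE andbT.
Qed.

Lemma sum_card_Phi_size (F : finFieldType) (k m : nat) :
  (\sum_(d < k.+1) #|[set z : 'M[F]_k * 'M[F]_(m, k) | size (Phi (col_mx z.1 z.2)) == d.+1]|
    = #|F| ^ (k * k) * #|F| ^ (m * k))%N.
Proof.
rewrite -!card_mx -card_prod -sum1_card.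
transitivity (\sum_(d < k.+1) \sum_(z : 'M[F]_k * 'M[F]_(m, k))
    nat_of_bool (size (Phi (col_mx z.1 z.2)) == d.+1)).
  by apply: eq_bigr => d _; rewrite -big_mkcond sum1dep_card.
rewrite exchange_big; apply: eq_bigr => z _ /=.
have [_ _ size_Phi] := Phi_spec z.1 z.2.
have lt_Phi : ((size (Phi (col_mx z.1 z.2))).-1 < k.+1)%N by rewrite size_Phi ltnS leq_subr.
rewrite -big_mkcond (big_pred1 (Ordinal lt_Phi)) // => d.
by rewrite /= -val_eqE /= size_Phi eqSS eq_sym.
Qed.

(** Sorting all pairs by the degree of [Phi] gives a triangular linear system for the [w d]; Newton
    interpolation of [(q ^+ m) ^+ k] at the nodes [q ^- j] shows that the product formula solves
    it. *)
Lemma natr_card_observable (F : finFieldType) (r m : nat) :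
  let q : rat := #|F|%:R in
  (card_observable F r m)%:R / (card_unitmx F r)%:R
  = \prod_(j < r) (q ^+ m - q ^- j) / Fq q r.
Proof.
move=> q; have q_gt1 : 1 < q := card_finField_gt1 F.
have q0 : q != 0 by rewrite gt_eqF // (lt_trans ltr01).
have F0 n := Fq_neq0 n q_gt1.
have g0 n : (card_unitmx F n)%:R != 0 :> rat by rewrite pnatr_eq0 -lt0n card_unitmx_gt0.
pose w n : rat := (card_observable F n m)%:R / (card_unitmx F n)%:R.
pose P n : rat := \prod_(j < n) (q ^+ m - q ^- j).
(* The sum is reversed so that [d] is the observable dimension; [q ^+ (j * j)] over the order of the
   invertible group is [1 / Fq q j]. *)
have sum_w k : \sum_(d < k.+1) w d / Fq q (k - d) = q ^+ (m * k) / Fq q k.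
  apply: (mulfI (g0 k)).
  transitivity (q ^+ (k * k) * q ^+ (m * k)); last first.
    by rewrite natr_card_unitmx -/q mulrACA mulfV // mulr1.
  rewrite -!natrX -natrM -sum_card_Phi_size natr_sum mulr_sumr [RHS](reindex_inj rev_ord_inj).
  apply: eq_bigr => d _; rewrite /= subSS.
  have le_dk : (d <= k)%N by rewrite -ltnS.
  have := card_Phi_size F m (esym (subnKC le_dk)).
  move/(congr1 (fun n : nat => n%:R : rat)); rewrite !natrM => E.
  apply: (mulIf (g0 d)); apply: (mulIf (g0 (k - d)%N)); rewrite -[RHS]mulrA E.
  rewrite natrX -/q (natr_card_unitmx F (k - d)) -/q /w.
  move: (g0 d) (F0 (k - d)%N).
  move: (card_unitmx F d)%:R (card_unitmx F k)%:R (Fq q _) (q ^+ _) (card_observable F d m)%:R.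
  by move=> a b c e o a0 c0; field; rewrite a0 c0.
suff: w r = P r / Fq q r by [].
have sum_P k : \sum_(d < k.+1) P d / Fq q d / Fq q (k - d) = q ^+ (m * k) / Fq q k.
  rewrite exprM -(gauss_binom_sum q^-1) mulr_suml; apply: eq_bigr => d _.
  have le_dk : (d <= k)%N by rewrite -ltnS.
  have -> : P d = \prod_(j < d) (q ^+ m - q^-1 ^+ j).
    by apply: eq_bigr => j _; rewrite exprVn.
  rewrite -(gauss_binomE q le_dk).
  have : gauss_binom q^-1 k d != 0.
    apply: contraTneq (F0 k) => G0.
    by rewrite -(gauss_binomE q le_dk) G0 mul0r eqxx.
  move: (gauss_binom _ _ _) (\prod_(j < d) _) (F0 d) (F0 (k - d)%N) => a b.
  by move: (Fq q d) (Fq q _) => x y x0 y0 a0; field; rewrite x0 y0 a0.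
elim/ltn_ind: r => r IHr.
have := sum_w r; rewrite -sum_P !big_ord_recr /= subnn /Fq big_ord0 !divr1 -/(Fq q r).
rewrite (eq_bigr (fun d : 'I_r => P d / Fq q d / Fq q (r - d))); last first.
  by move=> d _; rewrite IHr.
by move/addrI.
Qed.

(** * From pairs back to matrices: the final count *)

Lemma card_Phi_col_mx (F : finFieldType) (k m : nat) (f : {poly F}) :
  #|[set A : 'M[F]_(k + m, k) | Phi A == f]| =
  #|[set z : 'M[F]_k * 'M[F]_(m, k) | Phi (col_mx z.1 z.2) == f]|.
Proof.
have col_inj : injective (fun z : 'M[F]_k * 'M[F]_(m, k) => col_mx z.1 z.2).
  by move=> [T C] [T' C'] /eq_col_mx[/= -> ->].
rewrite -[RHS](card_imset _ col_inj); apply: eq_card => A; rewrite inE.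
apply/idP/imsetP => [PhiA | [z]]; last by rewrite inE => ? ->.
by exists (usubmx A, dsubmx A); rewrite ?inE /= vsubmxK.
Qed.

Unset Implicit Arguments.

Theorem theorem5 (F : finFieldType) (n k : nat) (f : {poly F})
    (s : seq ({poly F} * nat)) :
  (1 <= k)%N -> (k <= n)%N ->
  f \is monic -> ((size f).-1 <= k)%N ->
  uniq (map fst s) ->
  (forall pe, pe \in s -> [/\ pe.1 \is monic, irreducible_poly pe.1 & (0 < pe.2)%N]) ->
  f = \prod_(pe <- s) pe.1 ^+ pe.2 ->
  let q : rat := (#|F|)%:R in
  let d := (size f).-1 in
  (#|[set A : 'M[F]_(n, k) | Phi A == f]|)%:R =
    qbinom q k d * (q ^+ (d * d - d) * Fq q d
                    / \prod_(pe <- s) Fq (q ^+ (size pe.1).-1) pe.2)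
    * \prod_(d.+1 <= i < k.+1) (q ^+ n - q ^+ i).
Proof.
move=> _ le_kn f_mon le_dk s_uniq s_ok def_f q d.
have s_irr : monic_irreducible s.
  by move=> p /mapP[pe /s_ok[? ? _] ->].
have q_gt1 : 1 < q := card_finField_gt1 F.
have q0 : q != 0 by rewrite gt_eqF // (lt_trans ltr01).
rewrite -(subnKC le_kn); move: (n - k)%N => m {n le_kn}.
rewrite card_Phi_col_mx -(subnK le_dk) -/d; move: (k - d)%N => r {k le_dk}.
set Fs := \prod_(pe <- s) Fq _ _.
(* The local powers of [q] combine because the products of degree and exponent sum to [d]. *)
have weight_f : char_weight f = q ^- d / Fs.
  rewrite {1}def_f -[\prod_(pe <- s) _]/(factor_prod s) char_weight_factor_prod //.
  rewrite /prime_weight big_split /= !prodfV; congr (_^-1 * _).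
  rewrite /d def_f size_factor_prod // -prodrXr.
  by apply: eq_bigr => pe _; rewrite exprM.
have Fs0 : Fs != 0.
  rewrite prodf_seq_neq0; apply/allP => pe /s_ok[_ [p_size _] _]; apply: Fq_neq0.
  by rewrite exprn_egt1 // -lt0n -subn1 subn_gt0.
have F0 j := Fq_neq0 j q_gt1.
have g0 j : (card_unitmx F j)%:R != 0 :> rat by rewrite pnatr_eq0 -lt0n card_unitmx_gt0.
(* For [i = r + d - j] the factor is [q ^+ (r + d) * (q ^+ m - q ^- j)]. *)
have prodE : \prod_(d.+1 <= i < (r + d).+1) (q ^+ (r + d + m) - q ^+ i)
  = q ^+ ((r + d) * r) * \prod_(j < r) (q ^+ m - q ^- j).
  have -> : q ^+ ((r + d) * r) = \prod_(j < r) q ^+ (r + d).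
    by rewrite prodr_const card_ord exprM.
  rewrite -big_split /=.
  rewrite big_add1 /= -{1}[d]add0n big_addn addnK big_mkord (reindex_inj rev_ord_inj) /=.
  apply: eq_bigr => j _; rewrite mulrBr -exprD; congr (_ - _).
  have -> : (r + d = (r - j.+1 + d).+1 + j)%N.
    by rewrite -{1}(subnK (ltn_ord j)) addnAC addnS addSn.
  by rewrite exprD mulfK ?expf_neq0.
have := card_Phi_eq r m f_mon; rewrite -/d.
move/(congr1 (fun n : nat => n%:R : rat)); rewrite !natrM => cardE.
apply: (mulIf (g0 d)); apply: (mulIf (g0 r)).
rewrite -[LHS]mulrA [X in _ * X]mulrC cardE.
have -> : (card_char_poly f)%:R = char_weight f * (card_unitmx F d)%:R.
  by rewrite /char_weight divfK.
have -> : (card_observable F r m)%:R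
  = \prod_(j < r) (q ^+ m - q ^- j) / Fq q r * (card_unitmx F r)%:R.
  by rewrite -natr_card_observable divfK.
rewrite prodE weight_f natr_card_unitmx -/q.
(* The truncated difference is exact, since [d <= d * d]. *)
have -> : q ^+ ((r + d) * (r + d)) = q ^+ (d * r) * q ^+ (d * d - d) * q ^+ d * q ^+ ((r + d) * r).
  rewrite -!exprD -[(d * r + _ + d)%N]addnA subnK; last first.
    by case: (d) => // b; rewrite leq_pmulr.
  by rewrite -mulnDr [(d * _)%N]mulnC -mulnDr [(d + r)%N]addnC.
have Fq_rd : Fq q (r + d) = qbinom q (r + d) d * (Fq q d * Fq q r) / q ^+ (d * r).
  by rewrite qbinomE // mulrAC divff ?mul1r // expf_neq0.
have qdr0 : q ^+ (d * r) != 0 by rewrite expf_neq0.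
have qd0 : q ^+ d != 0 by rewrite expf_neq0.
rewrite Fq_rd; field.
by rewrite Fs0 F0 qd0 qdr0.
Qed.
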